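(* Let $P\ge2$ and consider the rank one PCP model with positive factor vectors $\boldsymbol a_p\in\mathbb R_+^{N_p}$, $p=1,\dots,P$, and parameter vector $\boldsymbol\theta=[\boldsymbol a_1^\top\cdots\boldsymbol a_P^\top]^\top$. For $p\in\{2,\dots,P\}$ write $\boldsymbol a_p=[a_{p1}\ \ \boldsymbol a_{p\bullet}^\top]^\top$, where $a_{p1}$ is the first entry of $\boldsymbol a_p$ and $\boldsymbol a_{p\bullet}\in\mathbb R_+^{N_p-1}$ contains the remaining entries. Let $\boldsymbol\theta_\bullet=[\boldsymbol a_1^\top\ \boldsymbol a_{2\bullet}^\top\cdots\boldsymbol a_{P\bullet}^\top]^\top\in\mathbb R_+^r$, where $r=\big(\sum_{p=1}^PN_p\big)-P+1$. Then: 1. The matrix $\mathcal I_F(\boldsymbol\theta):=-\mathbb E\big(\nabla^2_{\boldsymbol\theta_\bullet,\boldsymbol\theta_\bullet}\ell(\boldsymbol x|\boldsymbol\theta)\big)$ is nonsingular of rank $r$. 2. The expected Fisher information matrix $\mathcal I(\boldsymbol\theta)$ is singular of rank $r$. 3. With the coordinates of $\boldsymbol\theta$ ordered as $(\boldsymbol\theta_\bullet,a_{21},\dots,a_{P1})$, the rows of $$\mathbf H^\top:=\begin{bmatrix}-\mathcal I_{F,N}(\boldsymbol\theta)\,\mathcal I_F^{-1}(\boldsymbol\theta)&\mathbf I_{P-1}\end{bmatrix}\in\mathbb R^{(P-1)\times(r+P-1)}$$ form a basis of the nullspace of $\mathcal I(\boldsymbol\theta)$.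
   Context: Rank one PCP model: $\boldsymbol{\mathscr X}\in\mathbb N_0^{N_1\times\cdots\times N_P}$ has independent entries $x_{\boldsymbol i}\sim\mathrm{Poisson}\big(\prod_{p=1}^P\boldsymbol a_p(i_p)\big)$, $\boldsymbol i=(i_1,\dots,i_P)$; $\boldsymbol x=\mathrm{vec}(\boldsymbol{\mathscr X})$; $\mathbb R_+$ denotes the positive reals. The loglikelihood is $\ell(\boldsymbol x|\boldsymbol\theta)=\sum_{\boldsymbol i}\big[x_{\boldsymbol i}\log\prod_p\boldsymbol a_p(i_p)-\prod_p\boldsymbol a_p(i_p)-\log(x_{\boldsymbol i}!)\big]$. The expected Fisher information is $\mathcal I(\boldsymbol\theta)=\mathbb E\big[-\nabla^2_{\boldsymbol\theta,\boldsymbol\theta}\ell(\boldsymbol x|\boldsymbol\theta)\big]$, expectation over $\boldsymbol x$ under the model with parameter $\boldsymbol\theta$; it is a square matrix of order $\sum_pN_p=r+P-1$. Ordering the coordinates of $\boldsymbol\theta$ as $(\boldsymbol\theta_\bullet,a_{21},\dots,a_{P1})$ (i.e. permuting rows and columns of $\mathcal I(\boldsymbol\theta)$ accordingly), write $$\mathcal I(\boldsymbol\theta)=\begin{bmatrix}\mathcal I_F(\boldsymbol\theta)&\mathcal I_{F,N}^\top(\boldsymbol\theta)\\ \mathcal I_{F,N}(\boldsymbol\theta)&\mathcal I_N(\boldsymbol\theta)\end{bmatrix},$$ with $\mathcal I_F(\boldsymbol\theta)\in\mathbb R^{r\times r}$, $\mathcal I_{F,N}(\boldsymbol\theta)\in\mathbb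 R^{(P-1)\times r}$, $\mathcal I_N(\boldsymbol\theta)\in\mathbb R^{(P-1)\times(P-1)}$. $\mathbf I_{P-1}$ is the identity matrix of order $P-1$. *)

(* Defs.v *)
From mathcomp Require Import all_boot all_order all_algebra.
From mathcomp Require Import all_classical all_reals all_analysis.

Set Implicit Arguments.
Unset Strict Implicit.
Unset Printing Implicit Defensive.
Import Order.TTheory GRing.Theory Num.Theory.
Import numFieldNormedType.Exports.

Local Open Scope classical_set_scope.
Local Open Scope ring_scope.

Definition partial (R : realType) (n : nat) (k : 'I_n) (f : 'cV[R]_n -> R) :
    'cV[R]_n -> R :=
  'D_(delta_mx k 0) f.

(* The Hessian of f in the coordinates s 0, ..., s (m - 1) only, the other
   coordinates being held fixed. *)
Definition hess (R : realType) (n m : nat) (s : 'I_m -> 'I_n)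
    (f : 'cV[R]_n -> R) (t : 'cV[R]_n) : 'M[R]_m :=
  \matrix_(i, j) partial (s i) (partial (s j) f) t.

(* [fine] would send an infinite expectation to 0; the entries it is used on
   below are affine in Poisson variables, hence integrable. *)
Definition expect_mx (d : measure_display) (T : measurableType d)
    (R : realType) (Pr : probability T R) (m n : nat) (M : T -> 'M[R]_(m, n)) :
    'M[R]_(m, n) :=
  \matrix_(i, j) fine ('E_Pr[fun w => M w i j])%E.

Definition mutually_independent (d d' : measure_display)
    (T : measurableType d) (T' : measurableType d') (R : realType)
    (Pr : probability T R) (I : finType) (X : I -> {RV Pr >-> T'}) : Prop :=
  forall (J : {set I}) (A : I -> set T'), (forall i, measurable (A i)) ->
    (Pr [set w | forall i, i \in J -> A i (X i w)] =
     \prod_(i in J) Pr (X i @^-1` A i))%E.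

Section PCP.
Context (R : realType) (P : nat) (N : 'I_P -> nat).

Definition mindex : finType := {dffun forall p : 'I_P, 'I_(N p)}.

(* The p-th block [submxcol t p] of t is the p-th factor vector, so that
   t = \mxcol_p a p stacks the vectors a p. *)
Definition rate (t : 'cV[R]_(\sum_p N p)) (i : mindex) : R :=
  \prod_(p < P) submxcol t p (i p) 0.

Definition loglik (x : mindex -> nat) (t : 'cV[R]_(\sum_p N p)) : R :=
  \sum_(i : mindex)
    ((x i)%:R * ln (rate t i) - rate t i - ln ((x i)`!)%:R).

Definition rdim : nat := (\sum_(p < P) N p - P + 1)%N.

(* Coordinates of theta_bullet: everything but the first entries of the
   factor vectors other than the first one (blocks are numbered from 0). *)
Definition free : {set 'I_(\sum_p N p)} :=
  [set k | (tagnat.sig1 k == 0%N :> nat) || (0 < tagnat.sig2 k)%N].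

Hypotheses (hP : (2 <= P)%N) (hN : forall p, (0 < N p)%N).

Lemma card_free : #|free| = rdim.
Proof.
rewrite -sum1_card big_mkcond /= (reindex _ (tagnat.rank_bij_on (p_ := N))) /=.
have -> : (\sum_(j : {i : 'I_P & 'I_(N i)})
             (if tagnat.rank j \in free then 1 else 0) =
           \sum_(p < P) \sum_(j < N p) ((p == 0 :> nat) || (0 < j)%N))%N.
  rewrite sig_big_dep /=; apply: eq_bigr => -[p j] _ /=.
  by rewrite inE /tagnat.sig1 /tagnat.sig2 tagnat.rankK /=; case: (_ || _).
have E (p : 'I_P) : ((\sum_(j < N p) ((p == 0 :> nat) || (0 < j)%N)) +
                     (0 < p) = N p)%N.
  have := hN p; case: (N p) => // m _.
  rewrite big_ord_recl /= (eq_bigr (fun=> 1%N)) => [|j _]; last first.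
    by rewrite ?orbT.
  by rewrite sum1_card card_ord orbF; case: (val p) => [|k] /=;
    rewrite ?addn0 ?add0n ?addn1 ?add1n.
have S : (\sum_(p < P) (0 < p) + 1 = P)%N.
  case: (P) hP => // m _; rewrite big_ord_recl /= (eq_bigr (fun=> 1%N)) //.
  by rewrite sum1_card card_ord add0n addn1.
rewrite /rdim -[in RHS](eq_bigr _ (fun p _ => E p)) big_split /=.
set A := (\sum_(p < P) _)%N; set B := (\sum_(p < P) _)%N in S *.
rewrite -[in RHS]S subnDA addnK subnK // /A (bigD1 (Ordinal (ltnW hP))) //=.
rewrite (eq_bigr (fun=> 1%N)) // sum1_card card_ord.
exact: leq_trans (hN _) (leq_addr _ _).
Qed.

(* [enum_val] is increasing, so theta_bullet keeps the order of theta. *)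
Definition bullet (i : 'I_rdim) : 'I_(\sum_p N p) :=
  enum_val (cast_ord (esym card_free) i).

Lemma succ_subproof (k : 'I_P.-1) : (k.+1 < P)%N.
Proof. by rewrite -ltn_predRL. Qed.

(* The coordinate of a_{k+2,1}, for k = 0, ..., P - 2. *)
Definition pivot (k : 'I_P.-1) : 'I_(\sum_p N p) :=
  tagnat.Rank (Ordinal (succ_subproof k)) (Ordinal (hN _)).

(* The position in theta of the coordinates of (theta_bullet, a_21, ..., a_P1). *)
Definition reorder (i : 'I_(rdim + P.-1)) : 'I_(\sum_p N p) :=
  match fintype.split i with inl j => bullet j | inr k => pivot k end.

Lemma reorder_bij : bijective reorder.
Proof.
have card_eq : #|'I_(\sum_p N p)| = (rdim + P.-1)%N.
  have le_PN : (P <= \sum_p N p)%N.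
    by rewrite -[leqLHS]card_ord -sum1_card leq_sum.
  rewrite card_ord /rdim -addnA add1n prednK ?subnK //; exact: ltnW.
have bfree j : bullet j \in free by exact: enum_valP.
have pfree k : pivot k \notin free.
  by rewrite inE /tagnat.sig1 /tagnat.sig2 tagnat.rankK.
apply: inj_card_bij; last by rewrite card_eq card_ord.
move=> i i'; rewrite /reorder.
case: fintype.splitP => [j ij|k ik]; case: fintype.splitP => [j' ij'|k' ik'].
- by move=> /enum_val_inj/cast_ord_inj jj; apply: val_inj; rewrite /= ij ij' jj.
- by move=> e; have := bfree j; rewrite e (negbTE (pfree _)).
- by move=> e; have := bfree j'; rewrite -e (negbTE (pfree _)).
- move=> /(congr1 (@tagnat.sig1 _ _)); rewrite !tagnat.Rank1K => -[kk].
  by apply: val_inj; rewrite /= ik ik' kk.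
Qed.

Context (d : measure_display) (T : measurableType d) (Pr : probability T R).

Definition PCP_model (X : mindex -> {RV Pr >-> nat})
    (t : 'cV[R]_(\sum_p N p)) : Prop :=
  (forall (i : mindex) (k : nat),
     distribution Pr (X i) [set k] = (poisson_pmf (rate t i) k)%:E) /\
  mutually_independent X.

Context (X : mindex -> {RV Pr >-> nat}) (t : 'cV[R]_(\sum_p N p)).

Definition fisher : 'M[R]_(\sum_p N p) :=
  expect_mx Pr (fun w => - hess id (loglik (fun i => X i w)) t).

Definition fisherF : 'M[R]_rdim :=
  - expect_mx Pr (fun w => hess bullet (loglik (fun i => X i w)) t).

Definition fisher_reordered : 'M[R]_(rdim + P.-1) :=
  mxsub reorder reorder fisher.

Definition fisherFN : 'M[R]_(P.-1, rdim) := dlsubmx fisher_reordered.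

(* The two usual descriptions of I_F, as minus the expected Hessian in
   theta_bullet and as the leading block of the reordered I, agree. *)
Lemma fisherF_block : ulsubmx fisher_reordered = fisherF.
Proof.
apply/matrixP => i j; rewrite !mxE /reorder !(unsplitK (inl _)) /=.
rewrite [X in fine X](_ : _ = 'E_Pr[fun w =>
  (- partial (bullet i) (partial (bullet j) (loglik (fun i => X i w))) t)%R])%E;
  last by congr expectation; apply/funext => w; rewrite !mxE.
rewrite [X in - fine X](_ : _ = 'E_Pr[fun w =>
  (partial (bullet i) (partial (bullet j) (loglik (fun i => X i w))) t)%R])%E;
  last by congr expectation; apply/funext => w; rewrite !mxE.
rewrite unlock.
set f := fun w => (partial (bullet i) (partial (bullet j)
  (loglik (fun i => X i w))) t)%:E.
rewrite -[X in fine X = _]/(\int[Pr]_w (\- f)%E w)%E.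
rewrite integralE [in RHS]integralE funeposN funenegN.
by case: integral => [u| |]; case: integral => [v| |] //=;
  rewrite ?oppr0 // opprB.
Qed.

End PCP.

(* Main.v *)
Require Import Defs.
From mathcomp Require Import all_boot all_order all_algebra.
From mathcomp Require Import all_classical all_reals all_analysis.
From mathcomp Require Import measurable_realfun ring zify.

Set Implicit Arguments.
Unset Strict Implicit.
Unset Printing Implicit Defensive.
Import Order.TTheory GRing.Theory Num.Theory.
Import numFieldNormedType.Exports.
Local Open Scope ring_scope.

(** The loglikelihood is, up to a constant, the sum over the tensor entries i of
    x i log (rate i) - rate i. Since the mean of x i is rate i, the expected
    information is the Gram matrix

      I = sum over i of rate i * g i * (g i)^T,   g i = gradient of log (rate i)

    ([fisher_information]): the Hessian is affine in the data
    ([partial2_loglik]), so its expectation follows from the means of the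
    entries ([poisson_mean]). As log (rate i) is the sum over the blocks p of the log of
    the coordinate i p of block p, the quadratic form of I at v is

      sum over i of rate i * (sum over p of v p (i p) / t p (i p))^2

    and v is isotropic exactly when every inner sum vanishes
    ([information_form]). In such an additive function of the multi-index,
    changing one index at a time shows that v p j / t p j does not depend on j,
    and that the resulting constants c p add up to 0. These are the scale
    indeterminacies of a rank one tensor, a space of dimension P - 1.

    Freezing the first entries of the factor vectors of all blocks but block 0
    forces all c p to be 0, so the free block I_F is nonsingular
    ([ulsubmx_information_unit]). Conversely P - 1 independent null vectors are
    written down explicitly ([gauge], [gauge_null]), with an invertible diagonal
    matrix at the frozen coordinates ([gauge_pivot_unit]). A matrix with an
    invertible leading block of order r and s such null vectors, of order r + s,
    has rank r, and its kernel is given by the Schur complement formula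
    ([schur_kernel]); this yields the three claims. *)

(** * Gram forms, submatrices and the Schur complement *)

Lemma mxrank_mxsub_le (F : fieldType) (m n m' n' : nat) (f : 'I_m' -> 'I_m)
    (g : 'I_n' -> 'I_n) (A : 'M[F]_(m, n)) :
  (\rank (mxsub f g A) <= \rank A)%N.
Proof.
rewrite mxsubrc (leq_trans (mxrankS (rowsub_sub _ _))) //.
by rewrite -mxrank_tr -[leqRHS]mxrank_tr trmx_mxsub mxrankS // rowsub_sub.
Qed.

Lemma mxrank_mxsub_bij (F : fieldType) (m n m' n' : nat) (f : 'I_m' -> 'I_m)
    (g : 'I_n' -> 'I_n) (A : 'M[F]_(m, n)) :
  bijective f -> bijective g -> \rank (mxsub f g A) = \rank A.
Proof.
move=> [f' fK f'K] [g' gK g'K]; apply/eqP; rewrite eqn_leq mxrank_mxsub_le /=.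
have {1}-> : A = mxsub f' g' (mxsub f g A).
  by rewrite -mxsub_comp [RHS]mxsub_eq_id.
exact: mxrank_mxsub_le.
Qed.

Lemma mul_colsub_mxsub (F : pzSemiRingType) (m n n' q q' : nat)
    (s : 'I_n' -> 'I_n) (g : 'I_q' -> 'I_q) (A : 'M[F]_(m, n))
    (B : 'M[F]_(n, q)) :
  bijective s -> colsub s A *m mxsub s g B = colsub g (A *m B).
Proof.
move=> s_bij; apply/matrixP => i j; rewrite !mxE (reindex s) /=.
  by apply: eq_bigr => k _; rewrite !mxE.
exact: onW_bij.
Qed.

Lemma gram_apply (F : comPzRingType) (I J : finType) (r : I -> F)
    (s : I -> J -> F) (v : J -> F) (l : J) :
  \sum_k v k * (\sum_i r i * s i k * s i l) =
  \sum_i r i * s i l * (\sum_k s i k * v k).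
Proof.
under eq_bigr do rewrite mulr_sumr.
rewrite exchange_big; apply: eq_bigr => i _.
by rewrite mulr_sumr; apply: eq_bigr => k _; ring.
Qed.

Lemma gram_form (F : comPzRingType) (I J : finType) (r : I -> F)
    (s : I -> J -> F) (v : J -> F) :
  \sum_k \sum_l v k * (\sum_i r i * s i k * s i l) * v l =
  \sum_i r i * (\sum_k s i k * v k) ^+ 2.
Proof.
rewrite exchange_big; under eq_bigr do rewrite -mulr_suml gram_apply mulr_suml.
rewrite exchange_big; apply: eq_bigr => i _.
rewrite expr2 mulrA mulr_sumr; apply: eq_bigr => l _; ring.
Qed.

(** Rows K killing M with an invertible right block force the Schur
    complement of the leading block of M to vanish: once normalized to have
    right block 1, K can only be the H below, because K M = 0 read on the left
    columns determines its left block. The rank of M is at least r because of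
    the leading block and at most r because of H, so the kernel has nothing
    more than H. *)
Lemma schur_kernel (F : fieldType) (r s : nat) (M : 'M[F]_(r + s))
    (K : 'M[F]_(s, r + s)) :
    ulsubmx M \in unitmx -> rsubmx K \in unitmx -> K *m M = 0 ->
  let H := row_mx (- (dlsubmx M *m invmx (ulsubmx M))) 1%:M in
  [/\ \rank M = r, row_free H & (kermx M :=: H)%MS].
Proof.
move=> uA uK KM0 H.
have HE : H = invmx (rsubmx K) *m K.
  rewrite -[X in _ *m X]hsubmxK mul_mx_row mulVmx ?uK //; congr row_mx.
  have : lsubmx (K *m M) = 0 by rewrite KM0 linear0.
  rewrite -{1}[K]hsubmxK -{1}[M]submxK -{1}/(ulsubmx _) mul_row_block row_mxKl.
  move/(canRL (addrK _)); rewrite sub0r => E.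
  by rewrite -[lsubmx K](mulmxK uA) E !mulNmx mulmxN mulmxA mulKmx.
have rfH : row_free H.
  rewrite /row_free eqn_leq rank_leq_row -[leqLHS](mxrank1 F s) /=.
  rewrite -(row_mxKr (- (dlsubmx M *m invmx (ulsubmx M))) 1%:M) rsubmxEsub.
  exact: mxrank_mxsub_le.
have HM0 : (H <= kermx M)%MS.
  by apply/sub_kermxP; rewrite HE -mulmxA KM0 mulmx0.
have rM : \rank M = r.
  apply/eqP; rewrite eqn_leq; apply/andP; split.
    have := mxrankS HM0; rewrite (eqP rfH) mxrank_ker => le_s.
    have := rank_leq_row M; lia.
  rewrite -[leqLHS](mxrank_unit uA).
  by rewrite ulsubmxEsub mxrank_mxsub_le.
split=> //; apply/eqmxP; rewrite HM0 andbT.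
by rewrite -(mxrank_leqif_sup HM0) (eqP rfH) mxrank_ker rM addKn.
Qed.

(** * Mean of the Poisson distribution *)

Lemma poisson_pmf_sum (R : realType) (r : R) : 0 < r ->
  (\sum_(0 <= k <oo) (poisson_pmf r k)%:E = 1)%E.
Proof.
move=> r_gt0; have := probability_setT (poisson_prob r 0).
rewrite /= /poisson_prob r_gt0 -nneseries_esumT // => k.
by rewrite lee_fin poisson_pmf_ge0.
Qed.

(** The shift identity that reduces the mean to the total mass. *)
Lemma poisson_pmfS (R : realType) (r : R) k : 0 < r ->
  k.+1%:R * poisson_pmf r k.+1 = r * poisson_pmf r k.
Proof.
move=> r_gt0; rewrite /poisson_pmf r_gt0 factS natrM exprS.
have k0 : k`!%:R != 0 :> R by rewrite pnatr_eq0 -lt0n fact_gt0.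
by field; rewrite k0 nat1r pnatr_eq0.
Qed.

Lemma poisson_mean (d : measure_display) (T : measurableType d)
    (R : realType) (Pr : probability T R) (X : {RV Pr >-> nat}) (r : R) :
  0 < r ->
  (forall k, distribution Pr X [set k] = (poisson_pmf r k)%:E) ->
  (\int[Pr]_w ((X w)%:R : R)%:E = r%:E)%E.
Proof.
move=> r_gt0 Xpmf.
have mA k : measurable (X @^-1` [set k])%classic.
  by rewrite -[X in measurable X]setTI; exact: measurable_funPT.
(* X is the sum over k of k times the indicator of the event X = k. *)
transitivity (\int[Pr]_w \sum_(k <oo) (k%:R * \1_(X @^-1` [set k]) w)%:E)%E.
  apply: eq_integral => w _.
  rewrite (nneseries_split 0 (X w).+1); last first.
    by move=> k _; rewrite lee_fin mulr_ge0.
  rewrite [X in (_ + X)%E]eseries0 ?adde0.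
    rewrite big_mkord big_ord_recr /= big1 ?add0e => [|k _].
      by rewrite indicE mem_set // mulr1.
    rewrite indicE memNset ?mulr0 // /preimage /= => Xk.
    by have := ltn_ord k; rewrite -Xk ltnn.
  move=> k; rewrite add0n => lek _.
  rewrite indicE memNset ?mulr0 // /preimage /= => Xk.
  by rewrite Xk ltnn in lek.
rewrite integral_nneseries //; last first.
  by move=> k; apply/measurable_EFinP; apply: measurable_funM.
transitivity (\sum_(k <oo) (k%:R * poisson_pmf r k)%:E)%E.
  apply: eq_eseriesr => k _; under eq_integral do rewrite EFinM.
  rewrite ge0_integralZl //; last exact/measurable_EFinP.
  by rewrite integral_indic // setIT EFinM -Xpmf.
rewrite (nneseries_split 0 1) => [|k _]; last first.
  by rewrite lee_fin mulr_ge0 // poisson_pmf_ge0.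
rewrite big_mkord big_ord1 mul0r add0e add0n.
rewrite (_ : (\sum_(1 <= k <oo) _)%E =
             (\sum_(0 <= k <oo) (k.+1%:R * poisson_pmf r k.+1)%:E)%E).
  under eq_eseriesr do rewrite poisson_pmfS // EFinM.
  rewrite nneseriesZl ?poisson_pmf_sum ?mule1 // => k _.
  by rewrite lee_fin poisson_pmf_ge0.
by rewrite -nneseries_addn => [|k]; [apply: eq_eseriesr => k _; rewrite addn1|
  rewrite lee_fin mulr_ge0 // poisson_pmf_ge0].
Qed.

Lemma poisson_Lfun1 (d : measure_display) (T : measurableType d)
    (R : realType) (Pr : probability T R) (X : {RV Pr >-> nat}) (r : R) :
  0 < r ->
  (forall k, distribution Pr X [set k] = (poisson_pmf r k)%:E) ->
  (fun w => (X w)%:R : R) \in Lfun Pr 1.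
Proof.
move=> r_gt0 Xpmf; apply/Lfun1_integrable/integrableP; split.
  apply/measurable_EFinP.
  by apply: (measurableT_comp (f := fun k : nat => k%:R : R)).
rewrite [ltLHS](_ : _ = r%:E) ?ltry // -(poisson_mean r_gt0 Xpmf).
by apply: eq_integral => w _; rewrite abse_EFin normr_nat.
Qed.

(** The diagonal terms of the Hessian involve the data through the deviations
    of the observations from their means only; this is what removes them from
    the expected information. *)
Lemma expectation_centered (d : measure_display) (T : measurableType d)
    (R : realType) (Pr : probability T R) (I : Type) (r : seq I)
    (Y : I -> T -> R) (m c : I -> R) (a : R) :
  (forall i, Y i \in Lfun Pr 1) -> (forall i, 'E_Pr[Y i] = (m i)%:E)%E ->
  ('E_Pr[fun w => (a + \sum_(i <- r) (Y i w - m i) * c i)%R] = a%:E)%E.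
Proof.
move=> Y1 Ym.
have cst1 b : (cst b : T -> R) \in Lfun Pr 1 by exact: Lfun_cst.
have centered i : ('E_Pr[(Y i \- cst (m i))%R] = 0)%E.
  by rewrite expectationB // Ym expectation_cst subee.
have centered1 i : (c i \o* (Y i \- cst (m i))) \in Lfun Pr 1.
  by rewrite Lfun_scale ?rpredB.
have [S1 S0] : (fun w => \sum_(i <- r) (Y i w - m i) * c i) \in Lfun Pr 1 /\
    ('E_Pr[fun w => (\sum_(i <- r) (Y i w - m i) * c i)%R] = 0)%E.
  elim: r => [|i r [S1 S0]].
    under eq_fun do rewrite big_nil.
    by split; [exact: cst1|exact: expectation_cst].
  under eq_fun do rewrite big_cons.
  split; first exact: (rpredD (centered1 i) S1).
  rewrite (expectationD (X := c i \o* (Y i \- cst (m i)))) // S0 adde0.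
  by rewrite expectationZl ?centered ?mule0 // rpredB.
by rewrite (expectationD (X := cst a)) // S0 adde0 expectation_cst.
Qed.

(** * First and second derivatives of the loglikelihood *)

Lemma is_derive_bigsum (R : realType) (I : Type) (r : seq I)
    (f : I -> R -> R) (df : I -> R) (x v : R) :
  (forall i, is_derive x v (f i) (df i)) ->
  is_derive x v (fun y => \sum_(i <- r) f i y) (\sum_(i <- r) df i).
Proof.
move=> dfE; elim: r => [|i r IHr].
  rewrite big_nil; under eq_fun do rewrite big_nil.
  exact: is_derive_cst.
rewrite big_cons; under eq_fun do rewrite big_cons.
exact: is_deriveD.
Qed.

Lemma is_derive_affine (R : realType) (a b x : R) :
  is_derive x 1 (fun h : R => a + h * b) b.
Proof.
have := is_deriveD (is_derive_cst a x 1)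
  (is_deriveM (is_derive_id x 1) (is_derive_cst b x 1)).
by move=> /is_derive_eq; apply; rewrite scaler0 !add0r [b *: 1]mulr1.
Qed.

(** Reduces multivariate partial derivatives to the calculus of real functions
    of one variable. *)
Lemma partial_line (R : realType) (n : nat) (k : 'I_n) (f : 'cV[R]_n -> R)
    (t : 'cV[R]_n) :
  partial k f t = 'D_1 (fun h : R => f (h *: delta_mx k 0 + t)) 0.
Proof.
rewrite /partial /derive.
have E h : (f \o shift t) (h *: delta_mx k 0) - f t =
   ((fun h : R => f (h *: delta_mx k 0 + t)) \o shift 0) (h *: 1) -
    f (0 *: delta_mx k 0 + t).
  by rewrite /= scale0r add0r [h *: 1]mulr1 addr0.
by under eq_fun do rewrite E.
Qed.

(** Second derivatives need the first one on a neighbourhood, and its closed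
    form holds at positive points only. *)
Lemma near_line_gt0 (R : realType) (n : nat) (k : 'I_n) (t : 'cV[R]_n) :
  (forall m, 0 < t m 0) ->
  \forall h \near (0 : R), forall m, 0 < (h *: delta_mx k 0 + t) m 0.
Proof.
move=> t_gt0; near=> h => m.
have hk : - t k 0 < h by near: h; apply: lt_nbhsr; rewrite oppr_lt0.
rewrite !mxE eqxx andbT; have [->|_] /= := eqVneq m k.
  by rewrite mulr1 -ltrBlDr sub0r.
by rewrite mulr0 add0r.
Unshelve. all: by end_near. Qed.

Section Derivatives.
Context (R : realType) (P : nat) (N : 'I_P -> nat).
Implicit Types (t : 'cV[R]_(\sum_p N p)) (i : mindex N)
  (k l : 'I_(\sum_p N p)).

(** Whether the rate of the tensor entry i involves the coordinate k. *)
Definition hits i k : bool :=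
  i (tagnat.sig1 k) == tagnat.sig2 k.

(** The partial derivative of the log of the rate of i along the coordinate k,
    at positive t: the log rate is the sum of the logs of the coordinates that
    i hits. *)
Definition dlog_rate t i k : R := (hits i k)%:R / t k 0.

Local Notation Rank j := (@tagnat.Rank P N _ j).

Lemma eq_RankE i p k :
  (Rank (i p) == k) = hits i k && (p == tagnat.sig1 k).
Proof.
have [->|pk] := eqVneq p (tagnat.sig1 k); last first.
  by rewrite andbF; apply: contra_neqF pk => /eqP <-; rewrite tagnat.Rank1K.
rewrite andbT; apply/eqP/eqP => [|->]; last exact: tagnat.sig2K.
rewrite -[RHS]tagnat.sig2K => /eqP.
by rewrite -val_eqE tagnat.eq_Rank eqxx => /eqP/val_inj.
Qed.

Lemma hits_Rank i p (j : 'I_(N p)) : hits i (Rank j) = (i p == j).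
Proof.
have := eq_RankE i p (Rank j).
rewrite tagnat.Rank1K eqxx andbT => <-.
by rewrite -val_eqE tagnat.eq_Rank eqxx.
Qed.

Lemma rate_prod t i : rate t i = \prod_(p < P) t (Rank (i p)) 0.
Proof. by apply: eq_bigr => p _; rewrite mxE. Qed.

Lemma rate_gt0 t i : (forall k, 0 < t k 0) -> 0 < rate t i.
Proof. by move=> t_gt0; rewrite rate_prod; apply: prodr_gt0. Qed.

(** The rate is a product of distinct coordinates, hence affine along each of
    them. *)
Lemma rate_line t i k (h : R) : t k 0 != 0 ->
  rate (h *: delta_mx k 0 + t) i = rate t i + h * (rate t i * dlog_rate t i k).
Proof.
move=> tk0; rewrite /dlog_rate !rate_prod.
have field_id (u v : R) :
    u != 0 -> (u + h * 1) * v = u * v + h * (u * v * (1 / u)).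
  by move=> u0; field.
have E p : (h *: delta_mx k 0 + t) (Rank (i p)) 0 =
    t (Rank (i p)) 0 + h * (hits i k && (p == tagnat.sig1 k))%:R.
  by rewrite !mxE eqxx andbT eq_RankE addrC.
rewrite (eq_bigr _ (fun p _ => E p)) {E}.
have [hik|_] := boolP (hits i k); last first.
  rewrite (eq_bigr (fun p => t (Rank (i p)) 0)).
    by rewrite mul0r !mulr0 addr0.
  by move=> p _; rewrite andFb mulr0 addr0.
have tkE : t (Rank (i (tagnat.sig1 k))) 0 = t k 0.
  by rewrite (eqP hik) tagnat.sig2K.
rewrite (bigD1 (tagnat.sig1 k)) // andTb eqxx tkE.
rewrite [in RHS](bigD1 (tagnat.sig1 k)) // tkE.
rewrite [X in _ * X = _](eq_bigr (fun p => t (Rank (i p)) 0)); last first.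
  by move=> p /negbTE ->; rewrite mulr0 addr0.
exact: field_id.
Qed.

Lemma partial_loglik (x : mindex N -> nat) t k : (forall m, 0 < t m 0) ->
  partial k (loglik x) t = \sum_i ((x i)%:R - rate t i) * dlog_rate t i k.
Proof.
move=> t_gt0; rewrite partial_line.
have tk0 : t k 0 != 0 by rewrite gt_eqF.
apply: derive_val; apply: is_derive_bigsum => i.
have r0 : 0 < rate t i by exact: rate_gt0.
rewrite (_ : (fun _ => _) = (fun h : R => (x i)%:R *
    ln (rate t i + h * (rate t i * dlog_rate t i k)) -
    (rate t i + h * (rate t i * dlog_rate t i k)) - ln (x i)`!%:R)); last first.
  by apply/funext => h; rewrite rate_line.
set b := rate t i * _.
have dr : is_derive (0 : R) 1 (fun h => rate t i + h * b) b.
  exact: is_derive_affine.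
have dln : is_derive (0 : R) 1 (fun h => ln (rate t i + h * b))
    ((rate t i)^-1 * b).
  apply: (@is_derive1_comp _ (@ln R) (fun h => rate t i + h * b)) => //.
  by rewrite mul0r addr0; exact: is_derive1_ln.
have := is_deriveB (is_deriveB (is_deriveZ (x i)%:R dln) dr)
  (is_derive_cst (ln (x i)`!%:R) (0 : R) (1 : R)).
move=> /is_derive_eq; apply; rewrite subr0 mulrBl /b; congr (_ - _).
by rewrite mulrA mulVf ?mul1r ?gt_eqF.
Qed.

(** The first derivative along k is a sum of terms
    (x i - rate i) hits i k / t k. Deriving the rate gives the Gram term;
    deriving 1 / t k, which matters for l = k only, gives a term that is
    centered under the model. *)
Lemma partial2_loglik (x : mindex N -> nat) t k l : (forall m, 0 < t m 0) ->
  partial l (partial k (loglik x)) t =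
  - (\sum_i rate t i * dlog_rate t i k * dlog_rate t i l)
  - (k == l)%:R * \sum_i ((x i)%:R - rate t i) * dlog_rate t i k / t k 0.
Proof.
have field_id (u v a b r e c d : R) : c != 0 -> d != 0 ->
    u * (a * (- c ^- 2 * e)) + a * c^-1 * - (r * (b / d)) =
    - (r * (a / c) * (b / d) + e * (u * (a / c) / c)).
  by move=> c0 d0; field; rewrite c0.
move=> t_gt0; rewrite partial_line.
have tk0 : t k 0 != 0 by rewrite gt_eqF.
have tl0 : t l 0 != 0 by rewrite gt_eqF.
rewrite (@near_eq_derive _ _ _ _ (fun h : R => \sum_i
   ((x i)%:R - rate t i + h * - (rate t i * dlog_rate t i l)) *
   ((hits i k)%:R * (t k 0 + h * (k == l)%:R)^-1))); last first.
  near=> h; rewrite partial_loglik; last by near: h; exact: near_line_gt0.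
  apply: eq_bigr => i _; rewrite rate_line // /dlog_rate !mxE eqxx andbT.
  by rewrite mulrN opprD addrA [t k 0 + _]addrC.
rewrite mulr_sumr -opprD -big_split -sumrN.
apply: derive_val; apply: is_derive_bigsum => i.
set b := - (rate t i * _).
have df := is_derive_affine ((x i)%:R - rate t i) b 0.
have dg := is_derive_affine (t k 0) (k == l)%:R 0.
have g0 : t k 0 + 0 * (k == l)%:R != 0 by rewrite mul0r addr0.
have dV := @is_deriveV _ (fun h : R => t k 0 + h * (k == l)%:R) 0 _ 1 g0 dg.
have := is_deriveM df (is_deriveZ (hits i k)%:R dV).
move=> /is_derive_eq; apply; rewrite /b /dlog_rate /GRing.scale /=.
rewrite !mul0r !addr0.
exact: field_id.
Unshelve. all: by end_near. Qed.
End Derivatives.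

(** * The expected information as a Gram matrix *)

Section Gram.
Context (R : realType) (P : nat) (N : 'I_P -> nat).
Implicit Types (t : 'cV[R]_(\sum_p N p)) (i : mindex N)
  (k l m : 'I_(\sum_p N p)).
Local Notation Rank j := (@tagnat.Rank P N _ j).

Definition information t : 'M[R]_(\sum_p N p) :=
  \matrix_(k, l) \sum_i rate t i * dlog_rate t i k * dlog_rate t i l.

Lemma fisher_information (d : measure_display) (T : measurableType d)
    (Pr : probability T R) (X : mindex N -> {RV Pr >-> nat}) t :
  (forall m, 0 < t m 0) -> PCP_model X t -> fisher X t = information t.
Proof.
move=> t_gt0 [Xpmf _]; apply/matrixP => k l; rewrite [RHS]mxE mxE.
rewrite [X in fine X](_ : _ = 'E_Pr[fun w =>
  ((\sum_i rate t i * dlog_rate t i k * dlog_rate t i l) + \sum_i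
  ((X i w)%:R - rate t i) * ((l == k)%:R * dlog_rate t i l / t l 0))%R])%E.
  rewrite (@expectation_centered _ _ _ _ _ _ (fun i w => (X i w)%:R)) // => i.
    by have := poisson_Lfun1 (rate_gt0 i t_gt0) (Xpmf i).
  by rewrite unlock; exact: poisson_mean (rate_gt0 i t_gt0) (Xpmf i).
congr expectation; apply/funext => w; rewrite !mxE partial2_loglik //.
rewrite opprB opprK addrC mulr_sumr; congr (_ + _); apply: eq_bigr => i _.
  by rewrite mulrAC.
by rewrite -mulrA mulrCA !mulrA.
Qed.

(** The entry i hits exactly one coordinate in each block. *)
Lemma sum_dlog_rate t i (v : 'I_(\sum_p N p) -> R) :
  \sum_k dlog_rate t i k * v k = \sum_p v (Rank (i p)) / t (Rank (i p)) 0.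
Proof.
rewrite (reindex (@tagnat.rank P N)) /=; last exact: tagnat.rank_bij_on.
under eq_bigr do rewrite tagnat.rankE.
rewrite -(sig_big_dep (fun _ => true) (fun _ _ => true)
  (fun p (j : 'I_(N p)) => dlog_rate t i (Rank j) * v (Rank j))) /=.
apply: eq_bigr => p _; rewrite (bigD1 (i p)) //= big1 ?addr0 => [|j].
  by rewrite /dlog_rate hits_Rank eqxx mul1r mulrC.
by rewrite eq_sym /dlog_rate hits_Rank => /negbTE ->; rewrite !mul0r.
Qed.

Lemma information_sym t : (information t)^T = information t.
Proof.
by apply/matrixP => k l; rewrite !mxE; apply: eq_bigr => i _; rewrite mulrAC.
Qed.

Lemma information_form t (v : 'I_(\sum_p N p) -> R) :
  \sum_k \sum_l v k * information t k l * v l =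
  \sum_i rate t i * (\sum_k dlog_rate t i k * v k) ^+ 2.
Proof.
rewrite -gram_form; apply: eq_bigr => k _; apply: eq_bigr => l _.
by rewrite mxE.
Qed.

(** Rescaling the factor vectors by factors of product 1 keeps all the rates;
    the vector with entries t k * c (block of k) is the infinitesimal
    rescaling with rates c, along which every log rate varies by the sum of
    c, that is 0. *)
Lemma information_null t (c : 'I_P -> R) l : (forall m, 0 < t m 0) ->
  \sum_p c p = 0 ->
  \sum_k t k 0 * c (tagnat.sig1 k) * information t k l = 0.
Proof.
move=> t_gt0 c0.
rewrite (eq_bigr (fun k => t k 0 * c (tagnat.sig1 k) *
    \sum_i rate t i * dlog_rate t i k * dlog_rate t i l)); last first.
  by move=> k _; rewrite mxE.
rewrite gram_apply big1 // => i _.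
rewrite (sum_dlog_rate t i (fun k => t k 0 * c (tagnat.sig1 k))).
rewrite (eq_bigr c) ?c0 ?mulr0 // => p _.
rewrite tagnat.Rank1K mulrAC divff ?mul1r ?gt_eqF //.
Qed.

(** An additive function of the multi-index that vanishes everywhere has all
    its summands constant; fixing the value 0 at the first entry of every block
    but block 0 leaves no freedom, not even in block 0, since the constants add
    up to 0. *)
Lemma additive_eq0 (hN : forall p, (0 < N p)%N)
    (q : 'I_(\sum_p N p) -> R) :
  (forall i, \sum_p q (Rank (i p)) = 0) ->
  (forall k : 'I_P.-1, q (pivot hN k) = 0) -> forall m, q m = 0.
Proof.
move=> qsum qpiv.
pose first p : 'I_(N p) := Ordinal (hN p).
have off0 (p : 'I_P) : (0 < p)%N -> q (Rank (first p)) = 0.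
  move=> p_gt0.
  have ltp : (p.-1 < P.-1)%N by have := ltn_ord p; lia.
  rewrite -(qpiv (Ordinal ltp)) /pivot; congr q.
  rewrite -/(first _); congr (Rank (first _)).
  by apply: val_inj; rewrite /= prednK.
have first0 (p : 'I_P) : q (Rank (first p)) = 0.
  have [p0|/off0 //] := posnP p.
  rewrite -[RHS](qsum (finfun first)) (bigD1 p) //= big1 ?addr0 ?ffunE //.
  move=> p' p'p; rewrite ffunE off0 //.
  by move: p'p; rewrite -val_eqE /= p0 lt0n.
move=> m; rewrite -[m]tagnat.sig2K.
(* Compare with the multi-index that differs from the all-first one in the
   block of m only. *)
rewrite -[RHS](qsum (finfun
  (@dfwith _ (fun p => ordinal (N p)) first _ (tagnat.sig2 m)))).
rewrite (bigD1 (tagnat.sig1 m)) //= ffunE dfwithin big1 ?addr0 // => p pm.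
by rewrite ffunE dfwithout 1?eq_sym.
Qed.

(** The quadratic form is a sum of squares with positive weights, so its
    isotropic vectors v make every log rate stationary, and [additive_eq0]
    applies to v m / t m. *)
Lemma information_definite (hN : forall p, (0 < N p)%N)
    t (v : 'I_(\sum_p N p) -> R) : (forall m, 0 < t m 0) ->
  (forall k : 'I_P.-1, v (pivot hN k) = 0) ->
  \sum_k \sum_l v k * information t k l * v l = 0 -> forall m, v m = 0.
Proof.
move=> t_gt0 vpiv; rewrite information_form => /eqP.
rewrite psumr_eq0 => [/allP sq0 m|i _]; last first.
  by rewrite mulr_ge0 ?sqr_ge0 // ltW // rate_gt0.
have dlog0 i : \sum_p v (Rank (i p)) / t (Rank (i p)) 0 = 0.
  have := sq0 i (mem_index_enum _); rewrite /= mulf_eq0 gt_eqF ?rate_gt0 //=.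
  by rewrite sqrf_eq0 sum_dlog_rate => /eqP.
have := additive_eq0 (q := fun m => v m / t m 0) dlog0.
move=> /(_ hN _ m) /eqP; rewrite mulf_eq0 invr_eq0 (gt_eqF (t_gt0 m)) orbF.
by move=> /(_ _)/eqP; apply=> k; rewrite vpiv mul0r.
Qed.
End Gram.

(** * Null directions and the free block *)

Section Reordered.
Context (R : realType) (P : nat) (N : 'I_P -> nat).
Context (hP : (2 <= P)%N) (hN : forall p, (0 < N p)%N).
Context (t : 'cV[R]_(\sum_p N p)) (t_gt0 : forall m, 0 < t m 0).

Let sigma := reorder hP hN.
Let M : 'M[R]_(rdim N + P.-1) := mxsub sigma sigma (information t).

(** A left kernel vector of the leading block, padded with zeros, is isotropic
    for the whole information matrix and vanishes at the pivots. *)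
Lemma ulsubmx_information_unit : ulsubmx M \in unitmx.
Proof.
have [s sK Ks] := reorder_bij hP hN.
rewrite -row_free_unit; apply: inj_row_free => w wM0.
pose u : 'rV[R]_(rdim N + P.-1) := row_mx w 0.
have uM0 : u *m M *m u^T = 0.
  rewrite -[M]submxK tr_row_mx mul_row_block !mul0mx !addr0 wM0.
  by rewrite mul_row_col mul0mx trmx0 mulmx0 addr0.
have u0 m : u 0 (s m) = 0.
  move: m.
  have := @information_definite R P N hN t (fun m => u 0 (s m)) t_gt0.
  apply=> [k|].
    have -> : s (pivot hN k) = rshift (rdim N) k.
      by rewrite -[RHS]sK /reorder (unsplitK (inr k)).
    by rewrite row_mxEr mxE.
  move/matrixP/(_ 0 0): uM0; rewrite !mxE => uM0.
  rewrite exchange_big (reindex sigma) /=; last exact/onW_bij/reorder_bij.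
  rewrite -[RHS]uM0; apply: eq_bigr => l _; rewrite !mxE -mulr_suml.
  rewrite (reindex sigma) /=; last exact/onW_bij/reorder_bij.
  rewrite sK; congr (_ * _).
  by apply: eq_bigr => k _; rewrite sK [RHS]mulrC mulrC !mxE.
apply/rowP => j; have := u0 (sigma (lshift P.-1 j)).
by rewrite sK row_mxEl mxE.
Qed.

(** Row k is the infinitesimal rescaling that multiplies block k + 1 and divides
    block 0 by the same amount. *)
Definition gauge : 'M[R]_(P.-1, \sum_p N p) :=
  \matrix_(k, m) (t m 0 * ((tagnat.sig1 m == k.+1 :> nat)%:R
                           - (tagnat.sig1 m == 0%N :> nat)%:R)).

Lemma gauge_null : gauge *m information t = 0.
Proof.
have indic1 (p : 'I_P) : \sum_(q < P) (q == p :> nat)%:R = 1 :> R.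
  rewrite (bigD1 p) //= eqxx big1 ?addr0 // => q /negbTE.
  by rewrite -val_eqE /= => ->.
apply/matrixP => k l; rewrite mxE [RHS]mxE.
pose c (p : 'I_P) : R := (p == k.+1 :> nat)%:R - (p == 0%N :> nat)%:R.
have c0 : \sum_p c p = 0.
  by rewrite big_split /= sumrN (indic1 (Ordinal (succ_subproof k)))
    (indic1 (Ordinal (ltnW hP))) subrr.
rewrite -[RHS](information_null l t_gt0 c0).
by apply: eq_bigr => m _; rewrite [gauge k m]mxE.
Qed.

(** At the pivots the rescalings form a diagonal matrix with positive
    coefficients: each block but block 0 has exactly one pivot. *)
Lemma gauge_pivot_unit : rsubmx (colsub sigma gauge) \in unitmx.
Proof.
have -> : rsubmx (colsub sigma gauge) = diag_mx (\row_k t (pivot hN k) 0).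
  apply/matrixP => k l; rewrite !mxE /sigma /reorder (unsplitK (inr l)).
  rewrite tagnat.Rank1K /= subr0 eqSS val_eqE eq_sym /=.
  by have [->|] := eqVneq k l; rewrite ?mulr1 ?mulr0.
rewrite unitmxE det_diag unitfE; apply/prodf_neq0 => k _.
by rewrite mxE gt_eqF.
Qed.
End Reordered.

Theorem theorem4 (R : realType) (P : nat) (N : 'I_P -> nat)
    (hP : (2 <= P)%N) (hN : forall p, (0 < N p)%N)
    (a : forall p : 'I_P, 'cV[R]_(N p))
    (ha : forall (p : 'I_P) (j : 'I_(N p)), 0 < a p j 0)
    (d : measure_display) (T : measurableType d) (Pr : probability T R)
    (X : mindex N -> {RV Pr >-> nat})
    (hX : PCP_model X (\mxcol_(p < P) a p)) :
  let theta := \mxcol_(p < P) a p in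
  let I := fisher X theta in
  let IF := fisherF hP hN X theta in
  let I' := fisher_reordered hP hN X theta in
  let IFN := fisherFN hP hN X theta in
  let HT : 'M[R]_(P.-1, rdim N + P.-1) :=
    row_mx (- (IFN *m invmx IF)) 1%:M in
  (IF \in unitmx /\ \rank IF = rdim N) /\
  (I \notin unitmx /\ \rank I = rdim N) /\
  (row_free HT /\
   forall v : 'cV[R]_(rdim N + P.-1), I' *m v = 0 <-> (v^T <= HT)%MS).
Proof.
move=> theta I IF I' IFN HT.
have theta_gt0 m : 0 < theta m 0 by rewrite mxE.
have IE : I = information theta by exact: fisher_information.
have I'E : I' = mxsub (reorder hP hN) (reorder hP hN) (information theta).
  by rewrite /I' /fisher_reordered -/I IE.
have sigma_bij := reorder_bij hP hN.
have IFE : ulsubmx I' = IF by exact: fisherF_block.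
have IFu : IF \in unitmx by rewrite -IFE I'E; exact: ulsubmx_information_unit.
have K0 : colsub (reorder hP hN) (gauge theta) *m I' = 0.
  rewrite I'E mul_colsub_mxsub // gauge_null //.
  by apply/matrixP => k l; rewrite !mxE.
have := schur_kernel _ (gauge_pivot_unit hP hN theta_gt0) K0.
rewrite IFE => /(_ IFu) [rkI' freeHT kerI'].
have rkI : \rank I = rdim N by rewrite -rkI' I'E IE mxrank_mxsub_bij.
split; first by rewrite mxrank_unit.
split.
  split=> //; rewrite -row_free_unit /row_free rkI.
  have := bij_eq_card sigma_bij; rewrite !card_ord => <-.
  rewrite -[X in X == _]addn0 eqn_add2l; lia.
split=> // v.
have symI' : I'^T = I' by rewrite I'E trmx_mxsub information_sym.
rewrite -kerI'; split=> [vker|/sub_kermxP vker].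
  by apply/sub_kermxP; rewrite -symI' -trmx_mul vker trmx0.
by apply: trmx_inj; rewrite trmx_mul symI' vker trmx0.
Qed.
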